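(* Let $H$ and $K$ be two compact subgroups of a locally compact group $G$ with left Haar measures $dh$ and $dk$, respectively, and let $L:=H\cap K$ with left Haar measure $dl$. Let $d(kL)$ be the $K$-invariant Radon measure on $K/L$ and $d(hL)$ the $H$-invariant Radon measure on $H/L$, each normalized to have total mass $1$. Then the Radon transform $R_{K,H}:C_c(G/K:H)\to C_c(G/H:K)$ and its dual $R^*_{K,H}:C_c(G/H:K)\to C_c(G/K:H)$, defined by $$R_{K,H}f(xH)=\int_{H/L} f(xhK)\,d(hL),\qquad R^*_{K,H}\varphi(xK)=\int_{K/L}\varphi(xkH)\,d(kL)\qquad (x\in G),$$ are bijective linear operators. Furthermore, $(R_{K,H}f)_{\pi_{L,H}}=f_{\pi_{L,K}}$ for all $f\in C_c(G/K:H)$.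
   Context: Locally compact groups are Hausdorff. $C_c(X)$ denotes the space of continuous complex-valued functions with compact support on $X$. For compact subgroups $H,K$ of $G$, $$C_c(G/K:H):=\{f\in C_c(G/K) : f(xhK)=f(xK)\ \text{for all } x\in G,\ h\in H\},$$ and $C_c(G/H:K)$ is defined in the same way with the roles of $H$ and $K$ exchanged. The maps $\pi_{L,H}:G/L\to G/H$ and $\pi_{L,K}:G/L\to G/K$ are given by $\pi_{L,H}(xL)=xH$ and $\pi_{L,K}(xL)=xK$. For a function $\varphi$ on $G/H$ (respectively $G/K$) we write $\varphi_{\pi_{L,H}}:=\varphi\circ\pi_{L,H}$ (respectively $\varphi_{\pi_{L,K}}:=\varphi\circ\pi_{L,K}$). *)

(* Defs.v *)
From HB Require Import structures.
From mathcomp Require Import all_boot all_order all_algebra.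
From mathcomp Require Import complex.
From mathcomp Require Import all_classical all_reals all_analysis.

Set Implicit Arguments.
Unset Strict Implicit.
Unset Printing Implicit Defensive.

Import Order.TTheory GRing.Theory Num.Theory.
Import numFieldNormedType.Exports.

Local Open Scope classical_set_scope.
Local Open Scope quotient_scope.
Local Open Scope group_scope.

HB.mixin Record isTopologicalGroup G of Group G & Topological G := {
  mulg_continuous : continuous (fun p : G * G => p.1 * p.2) ;
  invg_continuous : continuous (fun x : G => x^-1)
}.

#[short(type="topologicalGroupType")]
HB.structure Definition TopologicalGroup :=
  {G of isTopologicalGroup G & Group G & Topological G}.

Section Subgroup.
Variables (G : topologicalGroupType) (H : groupClosed G).

Definition subgroup : Type := {x : G | x \in H}.

HB.instance Definition _ := SubChoice.copy subgroup {x : G | x \in H}.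

Fact subgroup_closed : group_closed (fun x : G => x \in H).
Proof.
split; first exact: gpred1.
by move=> x y Hx Hy; exact: gpredF.
Qed.

HB.instance Definition _ :=
  SubChoice_isSubGroup.Build G (fun x => x \in H) subgroup subgroup_closed.
HB.instance Definition _ :=
  Topological.copy subgroup (initial_topology (val : subgroup -> G)).
HB.instance Definition _ := isPointed.Build subgroup 1.

Fact subgroup_mulg_continuous :
  continuous (fun p : subgroup * subgroup => p.1 * p.2).
Proof.
apply/continuous_comp_initial => -[x y].
apply: (@continuous_comp _ _ _
  (fun p : subgroup * subgroup => (val p.1, val p.2)) (fun p => p.1 * p.2));
  last exact: mulg_continuous.
apply: cvg_pair => /=.
  apply: (@cvg_comp _ _ _ fst (val : subgroup -> G) _ (nbhs x)).
    exact: cvg_fst.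
  exact: initial_continuous.
apply: (@cvg_comp _ _ _ snd (val : subgroup -> G) _ (nbhs y)).
  exact: cvg_snd.
exact: initial_continuous.
Qed.

Fact subgroup_invg_continuous : continuous (fun x : subgroup => x^-1).
Proof.
apply/continuous_comp_initial => x.
apply: (@continuous_comp _ _ _ (val : subgroup -> G) (fun x => x^-1)).
  exact: initial_continuous.
exact: invg_continuous.
Qed.

HB.instance Definition _ := isTopologicalGroup.Build subgroup
  subgroup_mulg_continuous subgroup_invg_continuous.

End Subgroup.

Section IntersectionAndRelativeSubgroup.
Variable G : topologicalGroupType.

Definition capg (H K : groupClosed G) : {pred G} :=
  [pred x | (x \in H) && (x \in K)].

Section Cap.
Variables H K : groupClosed G.

Fact capg_mul : mulg_closed (capg H K).
Proof.
move=> x y; rewrite !inE => /andP[Hx Kx] /andP[Hy Ky].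
by rewrite !gpredM.
Qed.
Fact capg_one : 1 \in capg H K. Proof. by rewrite inE !gpred1. Qed.
Fact capg_inv : invg_closed (capg H K).
Proof. by move=> x; rewrite !inE !gpredV. Qed.

HB.instance Definition _ := isMulClosed.Build G (capg H K) capg_mul.
HB.instance Definition _ := isMul1Closed.Build G (capg H K) capg_one.
HB.instance Definition _ := isInvClosed.Build G (capg H K) capg_inv.
End Cap.

(* [insubg H L] is [L], or rather its trace on [H], as a subgroup of the group
   [subgroup H]. *)
Definition insubg (H L : groupClosed G) : {pred subgroup H} :=
  [pred x | val x \in L].

#[global] Arguments insubg H L : clear implicits.

Section InSub.
Variables H L : groupClosed G.

Fact insubg_mul : mulg_closed (insubg H L).
Proof. by move=> x y; rewrite !inE; exact: gpredM. Qed.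
Fact insubg_one : 1 \in insubg H L. Proof. by rewrite inE gpred1. Qed.
Fact insubg_inv : invg_closed (insubg H L).
Proof. by move=> x; rewrite !inE gpredV. Qed.

HB.instance Definition _ := isMulClosed.Build _ (insubg H L) insubg_mul.
HB.instance Definition _ := isMul1Closed.Build _ (insubg H L) insubg_one.
HB.instance Definition _ := isInvClosed.Build _ (insubg H L) insubg_inv.
End InSub.

End IntersectionAndRelativeSubgroup.

Arguments insubg {G} H L.

Section CosetSpace.
Variables (G : topologicalGroupType) (H : groupClosed G).

Definition lcoset_rel : rel G := fun x y => x^-1 * y \in H.

Fact lcoset_rel_refl : reflexive lcoset_rel.
Proof. by move=> x; rewrite /lcoset_rel mulVg gpred1. Qed.
Fact lcoset_rel_sym : symmetric lcoset_rel.
Proof. by move=> x y; rewrite /lcoset_rel -gpredV invgM invgK. Qed.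
Fact lcoset_rel_trans : transitive lcoset_rel.
Proof.
move=> y x z; rewrite /lcoset_rel => Hxy Hyz.
by rewrite -(mulVKg y z) mulgA gpredM.
Qed.

Canonical lcoset_equiv :=
  EquivRel lcoset_rel lcoset_rel_refl lcoset_rel_sym lcoset_rel_trans.

Definition coset_space : Type := quotient_topology {eq_quot lcoset_rel}.

HB.instance Definition _ := Quotient.on coset_space.
HB.instance Definition _ := Topological.on coset_space.

Definition lcoset (x : G) : coset_space := \pi_coset_space x.

HB.instance Definition _ := isPointed.Build coset_space (lcoset 1).

Lemma lcosetP x y : reflect (lcoset x = lcoset y) (x^-1 * y \in H).
Proof. exact: (@eqmodP _ (lcoset_equiv) x y). Qed.

End CosetSpace.

Definition borel (T : ptopologicalType) : Type :=
  g_sigma_algebraType (@open T).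
HB.instance Definition _ (T : ptopologicalType) := Measurable.on (borel T).

Section Measures.
Variable R : realType.
Local Open Scope ring_scope.
Local Open Scope ereal_scope.

Definition radon_measure (T : ptopologicalType)
    (mu : {measure set (borel T) -> \bar R}) : Prop :=
  [/\ forall C : set T, compact C -> mu C < +oo,
      forall A : set (borel T), measurable A ->
        mu A = ereal_inf [set mu U | U in [set U : set T | open U /\ A `<=` U]]
    & forall U : set T, open U ->
        mu U =
          ereal_sup [set mu C | C in [set C : set T | compact C /\ C `<=` U]]].

Definition left_haar_measure (G : topologicalGroupType) (H : groupClosed G)
    (mu : {measure set (borel (subgroup H)) -> \bar R}) : Prop :=
  [/\ radon_measure mu, mu setT != 0
    & forall (h : subgroup H) (A : set (borel (subgroup H))), measurable A ->
        mu [set (h * a)%g | a in (A : set (subgroup H))] = mu A].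

(* The left action of [G] on [G/H]: [g (xH) = (g x)H], see [lcoset_actE]. *)
Definition lcoset_act (G : topologicalGroupType) (H : groupClosed G)
  (g : G) (c : coset_space H) : coset_space H := lcoset H (g * repr c)%g.

Lemma lcoset_actE (G : topologicalGroupType) (H : groupClosed G) (g x : G) :
  lcoset_act g (lcoset H x) = lcoset H (g * x)%g.
Proof.
apply/lcosetP; rewrite invgM -mulgA mulKg; apply/lcosetP.
by rewrite /lcoset reprK.
Qed.

Definition invariant_measure (G : topologicalGroupType) (H : groupClosed G)
    (mu : {measure set (borel (coset_space H)) -> \bar R}) : Prop :=
  forall (g : G) (A : set (borel (coset_space H))), measurable A ->
    mu (lcoset_act g @` (A : set (coset_space H))) = mu A.

Definition Cintegral d (T : measurableType d) (mu : {measure set T -> \bar R})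
  (f : T -> R[i]) : R[i] :=
  Complex (\int[mu]_x complex.Re (f x))%R (\int[mu]_x complex.Im (f x))%R.

End Measures.

(* The usual topology of the complex plane, given by the modulus. *)
HB.instance Definition _ (R : realType) := NormedModule.copy R[i] R[i]^o.

Section FunctionSpaces.
Variable R : realType.
Local Open Scope ring_scope.

Definition Cc (T : topologicalType) : set (T -> R[i]) :=
  [set f | continuous f /\ compact (closure [set x | f x != 0])].

Lemma Cc0 (T : topologicalType) : @Cc T 0.
Proof.
split; first exact: cst_continuous.
rewrite (_ : [set x | _] = set0) ?closure0; first exact: compact0.
by apply/seteqP; split=> x //= /eqP.
Qed.

Lemma Cc_lin (T : topologicalType) (a : R[i]) (f g : T -> R[i]) :
  Cc f -> Cc g -> Cc (a *: f + g).
Proof.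
move=> [cf kf] [cg kg]; split.
  by move=> x; apply: cvgD; [apply: cvgZr; exact: cf|exact: cg].
apply: (@subclosed_compact _ _ (closure [set x | f x != 0]
                                `|` closure [set x | g x != 0])).
- exact: closed_closure.
- exact: compactU.
rewrite -closureU; apply: closureS => x /=; apply: contraPP => /not_orP[].
move=> /negP/negPn/eqP fx0 /negP/negPn/eqP gx0.
by rewrite !fctE fx0 gx0 scaler0 addr0 eqxx.
Qed.

Variable G : topologicalGroupType.

(* The vector space [C_c(G/K:H)], first as a predicate, then as a type. *)
Definition Cc_invariant (K H : groupClosed G) :
    {pred coset_space K -> R[i]} :=
  mem [set f : coset_space K -> R[i] | Cc f /\
    forall x h : G, h \in H -> f (lcoset K (x * h)%g) = f (lcoset K x)].

#[global] Arguments Cc_invariant K H : clear implicits.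

Definition CcInv (K H : groupClosed G) : Type :=
  {f : coset_space K -> R[i] | f \in Cc_invariant K H}.

Section CcInvLmodule.
Variables K H : groupClosed G.

Fact Cc_invariant_submod_closed : submod_closed (Cc_invariant K H).
Proof.
split; first by apply/mem_set; split; [exact: Cc0|].
move=> a f g /set_mem[Cf If] /set_mem[Cg Ig]; apply/mem_set; split.
  exact: Cc_lin.
by move=> x h Hh; rewrite !fctE If ?Ig.
Qed.

HB.instance Definition _ := GRing.isSubmodClosed.Build _ _ (Cc_invariant K H)
  Cc_invariant_submod_closed.

HB.instance Definition _ := SubChoice.copy (CcInv K H)
  {f : coset_space K -> R[i] | f \in Cc_invariant K H}.
HB.instance Definition _ := [SubChoice_isSubLmodule of CcInv K H by <:].

End CcInvLmodule.

End FunctionSpaces.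
Arguments Cc_invariant R {G} K H.

Section CosetMap.
Variable G : topologicalGroupType.

(* [pi_{L,H} : G/L -> G/H]; meaningful when [L] is contained in [H], see
   [coset_mapE]. *)
Definition coset_map (L H : groupClosed G) (c : coset_space L) :
  coset_space H := lcoset H (repr c).

Lemma coset_mapE (L H : groupClosed G) (x : G) :
  {subset L <= H} -> coset_map H (lcoset L x) = lcoset H x.
Proof.
move=> LH; apply/lcosetP/LH/lcosetP.
by rewrite /lcoset reprK.
Qed.

End CosetMap.

Section RadonIntegral.
Variables (R : realType) (G : topologicalGroupType).
Local Open Scope ring_scope.

(* For [L] contained in [M] and in [K], the function [mL |-> f(xmK)] on [M/L];
   it does not depend on the choice of representatives, see
   [radon_integrandE]. *)
Definition radon_integrand (M L K : groupClosed G)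
    (f : coset_space K -> R[i]) (x : G) :
    coset_space (insubg M L) -> R[i] :=
  fun c => f (lcoset K (x * val (repr c))%g).

Lemma radon_integrandE (M L K : groupClosed G) (f : coset_space K -> R[i])
    (x : G) (m : subgroup M) : {subset L <= K} ->
  radon_integrand f x (lcoset (insubg M L) m) = f (lcoset K (x * val m)%g).
Proof.
move=> LK; rewrite /radon_integrand; congr f; apply/lcosetP.
rewrite invgM -mulgA mulKg; apply: LK.
suff /lcosetP : lcoset (insubg M L) (repr (lcoset (insubg M L) m))
  = lcoset (insubg M L) m by [].
by rewrite /lcoset reprK.
Qed.

Definition radon_integral (M L K : groupClosed G)
    (mu : {measure set (borel (coset_space (insubg M L))) -> \bar R})
    (f : coset_space K -> R[i]) (x : G) : R[i] :=
  Cintegral mu (radon_integrand f x).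

End RadonIntegral.

(* Main.v *)
Require Import Defs.
From HB Require Import structures.
From mathcomp Require Import all_boot all_order all_algebra.
From mathcomp Require Import complex.
From mathcomp Require Import all_classical all_reals all_analysis.
Import Order.TTheory GRing.Theory Num.Theory.
Import numFieldNormedType.Exports.
Local Open Scope classical_set_scope.
Local Open Scope ring_scope.

(** A function in [CcInv R K H] is invariant under [H], so the integrand
    [hL |-> f(xhK)] is the constant [f(xK)] and, the total mass being 1, the
    Radon transform is plain transfer: [R f(xH) = f(xK)]
    ([radon_integral_invariant]).  Pulled back to [G], both [f] and [R f] are one
    and the same function, right invariant under [H] and under [K]; hence
    transfer from [G/K] to [G/H] and transfer from [G/H] to [G/K] are mutually
    inverse ([CcInv_transferK]), and on [G/L] both functions have the same pull
    back.

    What needs an argument is that transfer preserves [C_c] ([Cc_transfer]).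
    Continuity on a coset space is continuity of the pull back to [G].  For the
    support, let [Z] be the closure in [G] of the set where the common pull back
    does not vanish.  As [G] is locally compact and [K] is compact, the
    projection onto [G/K] is proper ([compact_preimage_lcoset]), so compactness
    of the support of [f] gives compactness of [Z].  As right translations are
    continuous and the pull back is right invariant under [H], [Z] is a union of
    [H]-cosets, so its image in [G/H] is closed ([closed_lcoset]);
    being also compact, it contains the support of [R f] as a closed subset. *)

Lemma continuous_mulgr (G : topologicalGroupType) (h : G) :
  continuous (fun x : G => (x * h)%g).
Proof.
move=> x; apply: (@continuous_comp _ _ _ (fun x : G => (x, h))
  (fun p : G * G => (p.1 * p.2)%g)); last exact: mulg_continuous.
by apply: cvg_pair => /=; [exact: cvg_id|exact: cvg_cst].
Qed.

Lemma compact_mulg (G : topologicalGroupType) (A B : set G) :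
  compact A -> compact B ->
  compact [set (p.1 * p.2)%g | p in A `*` B].
Proof.
move=> cA cB; apply: continuous_compact; last exact: compact_setX.
by apply: continuous_subspaceT; exact: mulg_continuous.
Qed.

Lemma closure_mulgr_stable (G : topologicalGroupType) (S : set G) (h : G) :
  (forall x, S x -> S (x * h)%g) ->
  forall x, closure S x -> closure S (x * h)%g.
Proof.
move=> Sh; have clP : closed ((fun x => x * h)%g @^-1` closure S).
  have /continuous_closedP := continuous_mulgr G h.
  by apply; exact: closed_closure.
move=> x Sx; apply: (clP x); move: x Sx; apply: closureS => x Sx.
exact/subset_closure/Sh.
Qed.

Section CosetProjection.
Context {G : topologicalGroupType} {H : groupClosed G}.

Lemma lcoset_continuous : continuous (lcoset H).
Proof. exact: pi_continuous. Qed.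

Lemma lcoset_mulr (x h : G) : h \in H -> lcoset H (x * h)%g = lcoset H x.
Proof. by move=> Hh; apply/esym/lcosetP; rewrite mulKg. Qed.

Lemma lcoset_repr (c : coset_space H) : lcoset H (repr c) = c.
Proof. by rewrite /lcoset reprK. Qed.

Lemma lcoset_eqP (x y : G) :
  lcoset H x = lcoset H y -> exists2 h, h \in H & y = (x * h)%g.
Proof. by move/lcosetP => Hh; exists (x^-1 * y)%g => //; rewrite mulVKg. Qed.

(** The preimage of the image of [U] is the union of the right translates of [U]
    by the elements of [H]. *)
Lemma open_lcoset (U : set G) : open U -> open (lcoset H @` U).
Proof.
move=> oU; rewrite /open/= /quotient_open.
rewrite (_ : _ @^-1` _ =
    \bigcup_(h in [set` H]) ((fun x => x * h)%g @^-1` U)); last first.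
  apply/seteqP; split=> x /=.
    move=> [u Uu /esym/lcoset_eqP[h Hh uE]]; exists h => //=.
    by rewrite -uE.
  by move=> [h Hh Uxh]; exists (x * h)%g => //; exact: lcoset_mulr.
apply: bigcup_open => h _.
by have /continuousP := continuous_mulgr G h; apply.
Qed.

(** A union of cosets is the full preimage of its image, so its closedness is
    that of its image by the definition of the quotient topology. *)
Lemma closed_lcoset (Z : set G) :
  (forall x h, h \in H -> Z x -> Z (x * h)%g) -> closed Z ->
  closed (lcoset H @` Z).
Proof.
move=> ZH clZ; rewrite -openC /open/= /quotient_open.
rewrite (_ : _ @^-1` _ = ~` Z) ?openC//.
apply/seteqP; split=> x /=; apply: contra_not; first by exists x.
by move=> [z Zz /lcoset_eqP[h Hh ->]]; exact: ZH.
Qed.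

(** The images of the interiors of compact neighbourhoods form an open cover of
    [G/H]; finitely many of them cover [C], and the union of the corresponding
    neighbourhoods is compact. *)
Lemma compact_lift_lcoset (C : set (coset_space H)) :
  locally_compact [set: G] -> compact C ->
  exists2 Q : set G, compact Q & C `<=` lcoset H @` Q.
Proof.
move=> lcG cC.
have /choice[V VP] : forall x : G, exists V : set G, nbhs x V /\ compact V.
  move=> x; have [V nV [cV _]] := lcG x Logic.I.
  by exists V; split=> //; move: nV; rewrite withinET.
move: cC; rewrite compact_cover => /(_ G setT (fun x => lcoset H @` (V x)°)).
case.
- by move=> x _; apply: open_lcoset; exact: open_interior.
- move=> c _; exists (repr c) => //=; exists (repr c); last exact: lcoset_repr.
  exact: (VP _).1.
move=> D _ CD; exists (\big[setU/set0]_(x <- finmap.enum_fset D) V x).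
  by apply: bigsetU_compact => x _; exact: (VP x).2.
move=> c /CD[x /= xD [y Vy <-]]; exists y => //.
rewrite -bigcup_seq; exists x => //.
exact: interior_subset.
Qed.

(** Properness of the projection: [Z] is a closed subset of [Q H], for a compact
    [Q] whose image covers [C]. *)
Lemma compact_preimage_lcoset (C : set (coset_space H)) (Z : set G) :
  locally_compact [set: G] -> compact [set` H] -> compact C ->
  closed Z -> lcoset H @` Z `<=` C -> compact Z.
Proof.
move=> lcG cH cC clZ ZC; have [Q cQ CQ] := compact_lift_lcoset _ lcG cC.
apply: (subclosed_compact clZ (compact_mulg _ _ _ cQ cH)) => z Zz.
have /CQ[q Qq /lcoset_eqP[h Hh zE]] : C (lcoset H z) by apply: ZC; exists z.
by exists (q, h).
Qed.

End CosetProjection.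

(** The two supports are compared through the support [Z] of the common pull back
    to [G], which is compact because of [f] and a union of [H]-cosets because of
    [g]. *)
Lemma Cc_transfer (R : realType) (G : topologicalGroupType)
    (H K : groupClosed G)
    (f : coset_space K -> R[i]) (g : coset_space H -> R[i]) :
  locally_compact [set: G] -> compact [set` K] ->
  g \o lcoset H = f \o lcoset K -> Cc f -> Cc g.
Proof.
move=> lcG cK gf [cf kf].
have gfE x : g (lcoset H x) = f (lcoset K x) by exact: (congr1 (@^~ x) gf).
split.
  apply/quotient_continuous; rewrite -/(lcoset H) gf.
  move=> x; apply: continuous_comp; [exact: lcoset_continuous|exact: cf].
pose Z := closure [set x | f (lcoset K x) != 0].
have cZ : compact Z.
  apply: (compact_preimage_lcoset _ _ lcG cK kf); first exact: closed_closure.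
  move=> _ [x Zx <-].
  have /continuous_closedP := @lcoset_continuous G K.
  move=> /(_ _ (@closed_closure _ [set c | f c != 0])); apply.
  by move: x Zx; apply: closureS => x fx; exact: subset_closure.
have clZ : closed (lcoset H @` Z).
  apply: closed_lcoset; last exact: closed_closure.
  move=> x h Hh; apply: closure_mulgr_stable => y /=.
  by rewrite -!gfE lcoset_mulr.
apply: (@subclosed_compact _ _ (lcoset H @` Z)); first exact: closed_closure.
  apply: continuous_compact cZ; apply: continuous_subspaceT.
  exact: lcoset_continuous.
move/closure_id : clZ => ->; apply: closureS => c /= gc.
exists (repr c); last exact: lcoset_repr.
by apply: subset_closure; rewrite /= -gfE lcoset_repr.
Qed.

Lemma CcInv_mulr (R : realType) (G : topologicalGroupType) (K H : groupClosed G)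
    (f : CcInv R K H) (x h : G) :
  h \in H -> val f (lcoset K (x * h)%g) = val f (lcoset K x).
Proof. by move=> Hh; have /set_mem[_] := valP f; exact. Qed.

(** The transferred function is the pull back of [f] along [coset_map], that is
    [xH |-> f(yK)] for a chosen representative [y] of [xH]; invariance of [f]
    under [H] makes the choice immaterial. *)
Lemma CcInv_transfer (R : realType) (G : topologicalGroupType)
    (K H : groupClosed G) :
  locally_compact [set: G] -> compact [set` K] ->
  exists T : {linear CcInv R K H -> CcInv R H K},
    forall f x, val (T f) (lcoset H x) = val f (lcoset K x).
Proof.
move=> lcG cK; pose t (f : CcInv R K H) := val f \o @coset_map G H K.
have tE f x : t f (lcoset H x) = val f (lcoset K x).
  have /lcoset_eqP[h Hh {2}->] := lcoset_repr (lcoset H x).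
  by rewrite CcInv_mulr.
have tP f : t f \in Cc_invariant R H K.
  apply/mem_set; split; last by move=> x k Kk; rewrite !tE lcoset_mulr.
  have /set_mem[Cf _] := valP f.
  by apply: Cc_transfer lcG cK _ Cf; apply/funext => x /=; exact: tE.
pose T f : CcInv R H K := Sub (t f) (tP f).
have linT : linear T by move=> a f g; apply/val_inj/funext.
pose mT := GRing.isLinear.Build _ _ _ _ T linT.
pose lT : {linear CcInv R K H -> CcInv R H K} := HB.pack T mT.
by exists lT.
Qed.

Lemma Cintegral_cst d (T : measurableType d) (R : realType)
    (mu : {measure set T -> \bar R}) (z : R[i]) :
  mu setT = 1%E -> Cintegral mu (fun=> z) = z.
Proof.
move=> mu1; rewrite /Cintegral !Rintegral_cst ?mu1 ?mulr1 //.
by case: z.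
Qed.

(** The representatives of the cosets over which one integrates lie in [H], and
    [f] does not see them: the integrand is constant. *)
Lemma radon_integral_invariant (R : realType) (G : topologicalGroupType)
    (K H L : groupClosed G)
    (mu : {measure set (borel (coset_space (insubg H L))) -> \bar R})
    (f : CcInv R K H) (x : G) :
  mu setT = 1%E -> radon_integral mu (val f) x = val f (lcoset K x).
Proof.
move=> mu1; rewrite -[RHS](Cintegral_cst _ _ _ mu _ mu1); congr Cintegral.
by apply/funext => c; apply: CcInv_mulr; exact: valP.
Qed.

Lemma CcInv_transferK (R : realType) (G : topologicalGroupType)
    (K H : groupClosed G)
    (T : CcInv R K H -> CcInv R H K) (T' : CcInv R H K -> CcInv R K H) :
  (forall f x, val (T f) (lcoset H x) = val f (lcoset K x)) ->
  (forall f x, val (T' f) (lcoset K x) = val f (lcoset H x)) ->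
  cancel T T'.
Proof.
move=> TE T'E f; apply/val_inj/funext => c.
by rewrite -(lcoset_repr c) T'E TE.
Qed.

Theorem proposition3p6 (R : realType) (G : topologicalGroupType)
  (hausdorffG : hausdorff_space G) (locally_compactG : locally_compact [set: G])
  (H K : groupClosed G) (compactH : compact [set` H]) (compactK : compact [set` K])
  (dh : {measure set (borel (subgroup H)) -> \bar R})
  (dk : {measure set (borel (subgroup K)) -> \bar R})
  (dl : {measure set (borel (subgroup (capg H K))) -> \bar R})
  (haar_dh : left_haar_measure dh)
  (haar_dk : left_haar_measure dk)
  (haar_dl : left_haar_measure dl)
  (dkL : {measure set (borel (coset_space (insubg K (capg H K)))) -> \bar R})
  (dhL : {measure set (borel (coset_space (insubg H (capg H K)))) -> \bar R})
  (radon_dkL : radon_measure dkL) (invariant_dkL : invariant_measure dkL)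
  (mass_dkL : dkL setT = 1%E)
  (radon_dhL : radon_measure dhL) (invariant_dhL : invariant_measure dhL)
  (mass_dhL : dhL setT = 1%E) :
  exists (RKH : {linear CcInv R K H -> CcInv R H K})
         (RKHstar : {linear CcInv R H K -> CcInv R K H}),
    (forall (f : CcInv R K H) (x : G),
       val (RKH f) (lcoset H x) = radon_integral dhL (val f) x) /\
    (forall (phi : CcInv R H K) (x : G),
       val (RKHstar phi) (lcoset K x) = radon_integral dkL (val phi) x) /\
    bijective RKH /\
    bijective RKHstar /\
    (forall f : CcInv R K H,
       val (RKH f) \o @coset_map G (capg H K) H
       = val f \o @coset_map G (capg H K) K).
Proof.
have [T TE] := CcInv_transfer R G K H locally_compactG compactK.
have [T' T'E] := CcInv_transfer R G H K locally_compactG compactH.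
have TK : cancel T T' by exact: CcInv_transferK.
have T'K : cancel T' T by exact: CcInv_transferK.
exists T, T'; split; first by move=> f x; rewrite radon_integral_invariant.
split; first by move=> f x; rewrite radon_integral_invariant.
split; first by exists T'.
split; first by exists T.
by move=> f; apply/funext => c; exact: TE.
Qed.
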